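(* Let $G$ be a Lie group with Lie algebra $\mathfrak{g}$ and let $g_1(t),\dots,g_N(t)\in G$ be the (differentiable) trajectories of $N$ agents. Let $\xi^l_k(t),\xi^r_k(t)\in\mathfrak{g}$ denote the left-invariant and right-invariant velocities of agent $k$. Then left-invariant coordination (all $g_k^{-1}g_j$ constant in time, for all $j,k$) is equivalent to equality of the right-invariant velocities, $\xi^r_j=\xi^r_k$ for all $j,k$ (at all times); and right-invariant coordination (all $g_jg_k^{-1}$ constant in time, for all $j,k$) is equivalent to equality of the left-invariant velocities, $\xi^l_j=\xi^l_k$ for all $j,k$ (at all times).
   Context: For $h\in G$ let $L_h:g\mapsto hg$ and $R_h:g\mapsto gh$, with induced tangent maps $L_{h*}$, $R_{h*}$. The left-invariant velocity of agent $k$ at time $\tau$ is $\xi^l_k(\tau)=L_{g_k^{-1}(\tau)*}\big(\tfrac{d}{dt}g_k(t)|_{t=\tau}\big)\in\mathfrak{g}$; the right-invariant velocity is $\xi^r_k(\tau)=R_{g_k^{-1}(\tau)*}\big(\tfrac{d}{dt}g_k(t)|_{t=\tau}\big)\in\mathfrak{g}$. The left-invariant relative position of agent $j$ with respect to agent $k$ is $\lambda_{jk}=g_k^{-1}g_j$; the right-invariant relative position is $\rho_{jk}=g_jg_k^{-1}$. Left-invariant coordination means that $\lambda_{jk}(t)$ is constant for all pairs $j,k$; right-invariant coordination means that $\rho_{jk}(t)$ is constant for all pairs $j,k$. *)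

(* Defs.v *)
From HB Require Import structures.
From mathcomp Require Import all_boot all_order all_algebra.
From mathcomp Require Import all_classical all_reals all_analysis.
Set Implicit Arguments.
Unset Strict Implicit.
Unset Printing Implicit Defensive.
Import Order.TTheory GRing.Theory Num.Theory.
Import numFieldNormedType.Exports.
Local Open Scope classical_set_scope.
Local Open Scope ring_scope.

(* For [U] open in a finite-dimensional [V]: then derivatives at points of [U]
   only depend on the restriction of [f] to [U], and testing all directional
   derivatives amounts to testing the iterated partial derivatives. *)
Fixpoint Ck_on (R : realType) (V W : normedModType R) (k : nat)
    (U : set V) (f : V -> W) : Prop :=
  match k with
  | 0 => forall x, U x -> {for x, continuous f}
  | k'.+1 => (forall x, U x -> differentiable f x) /\
             (forall v : V, Ck_on k' U ('D_v f))
  end.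

Definition smooth_on (R : realType) (V W : normedModType R)
    (U : set V) (f : V -> W) : Prop := forall k, Ck_on k U f.

(* Partial maps are represented by total ones: the values of [chart_fun]
   outside [chart_dom], and those of [chart_inv] outside
   [chart_fun @` chart_dom], are irrelevant. *)
Record chart (M V : Type) := Chart {
  chart_dom : set M ;
  chart_fun :> M -> V ;
  chart_inv : V -> M }.

Definition chart_codom (M V : Type) (c : chart M V) : set V :=
  c @` chart_dom c.

Definition is_chart (R : realType) (M : topologicalType) (V : normedModType R)
    (c : chart M V) : Prop :=
  [/\ open (chart_dom c), open (chart_codom c),
      forall p, chart_dom c p -> chart_inv c (c p) = p,
      forall p, chart_dom c p -> {for p, continuous c} &
      forall x, chart_codom c x -> {for x, continuous (chart_inv c)}].

Definition prod_chart (M N V W : Type) (c : chart M V) (d : chart N W) :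
    chart (M * N) (V * W) :=
  Chart (chart_dom c `*` chart_dom d)
        (fun p => (c p.1, d p.2))
        (fun x => (chart_inv c x.1, chart_inv d x.2)).

Definition prod_atlas (M N V W : Type) (A : set (chart M V))
    (B : set (chart N W)) : set (chart (M * N) (V * W)) :=
  [set prod_chart c d | c in A & d in B].

Definition in_charts (M N V W : Type) (c : chart M V) (d : chart N W)
    (f : M -> N) : V -> W :=
  fun x => d (f (chart_inv c x)).

Definition in_charts_dom (M N V W : Type) (c : chart M V) (d : chart N W)
    (f : M -> N) : set V :=
  c @` (chart_dom c `&` f @^-1` chart_dom d).

Definition smooth_map (R : realType) (M N : topologicalType)
    (V W : normedModType R) (A : set (chart M V)) (B : set (chart N W))
    (f : M -> N) : Prop :=
  continuous f /\
  forall c d, A c -> B d -> smooth_on (in_charts_dom c d f) (in_charts c d f).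

(* The atlas need not be maximal; [chart_at p] is a preferred chart around
   [p]. *)
HB.mixin Record isSmoothManifold (R : realType) (n : nat) M
    of Topological M := {
  manifold_hausdorff : hausdorff_space M ;
  manifold_second_countable : @second_countable M ;
  atlas : set (chart M 'rV[R]_n) ;
  atlas_chart : forall c, atlas c -> is_chart c ;
  atlas_compatible : forall c d, atlas c -> atlas d ->
    smooth_on (in_charts_dom c d id) (in_charts c d id) ;
  chart_at : M -> chart M 'rV[R]_n ;
  chart_at_atlas : forall p, atlas (chart_at p) ;
  chart_at_dom : forall p, chart_dom (chart_at p) p }.

#[short(type="smoothManifoldType")]
HB.structure Definition SmoothManifold (R : realType) (n : nat) :=
  { M of Topological M & isSmoothManifold R n M }.

(* A tangent vector at [p] is represented by its coordinates in the preferred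
   chart around [p], which identifies [T_p M] with [R^n] as a vector space. *)
Definition tangent_space (R : realType) (n : nat)
    (M : smoothManifoldType R n) (p : M) : normedModType R := 'rV[R]_n.

Definition tangent_map (R : realType) (m n : nat)
    (M : smoothManifoldType R m) (N : smoothManifoldType R n)
    (f : M -> N) (p : M) : tangent_space p -> tangent_space (f p) :=
  'd (in_charts (chart_at p) (chart_at (f p)) f) (chart_at p p).

(* Continuity is required separately, since [chart_at (g t)] is meaningless
   outside its domain. *)
Definition differentiable_curve (R : realType) (n : nat)
    (M : smoothManifoldType R n) (g : R -> M) (t : R) : Prop :=
  {for t, continuous g} /\ derivable (chart_at (g t) \o g) t 1.

Definition velocity (R : realType) (n : nat)
    (M : smoothManifoldType R n) (g : R -> M) (t : R) : tangent_space (g t) :=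
  derive1 (chart_at (g t) \o g) t.

HB.mixin Record isLieGroup (R : realType) (n : nat) G
    of SmoothManifold R n G & Group G := {
  mulg_smooth : smooth_map (prod_atlas (@atlas R n G) (@atlas R n G))
    (@atlas R n G) (fun p : G * G => (p.1 * p.2)%g) ;
  invg_smooth : smooth_map (@atlas R n G) (@atlas R n G)
    (fun p : G => p^-1%g) }.

#[short(type="lieGroupType")]
HB.structure Definition LieGroup (R : realType) (n : nat) :=
  { G of SmoothManifold R n G & Group G & isLieGroup R n G }.

(* Only the underlying vector space, i.e. the tangent space at the identity:
   the bracket is not needed to compare velocities. *)
Definition lie_algebra (R : realType) (n : nat) (G : lieGroupType R n) :
    normedModType R := tangent_space (1%g : G).

Definition left_translation (R : realType) (n : nat) (G : lieGroupType R n)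
    (h : G) : G -> G := fun g => (h * g)%g.

Definition right_translation (R : realType) (n : nat) (G : lieGroupType R n)
    (h : G) : G -> G := fun g => (g * h)%g.

(* The tangent vectors below live at [(g t)^-1 * g t] and [g t * (g t)^-1].
   As these points are equal to [1], so are their preferred charts, and the
   tangent spaces there are [lie_algebra G]. *)
Definition left_velocity (R : realType) (n : nat) (G : lieGroupType R n)
    (g : R -> G) (t : R) : lie_algebra G :=
  tangent_map (left_translation (g t)^-1%g) (velocity g t).

Definition right_velocity (R : realType) (n : nat) (G : lieGroupType R n)
    (g : R -> G) (t : R) : lie_algebra G :=
  tangent_map (right_translation (g t)^-1%g) (velocity g t).

Definition left_relative_position (R : realType) (n N : nat)
    (G : lieGroupType R n) (g : 'I_N -> R -> G) (j k : 'I_N) (t : R) : G :=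
  ((g k t)^-1 * g j t)%g.

Definition right_relative_position (R : realType) (n N : nat)
    (G : lieGroupType R n) (g : 'I_N -> R -> G) (j k : 'I_N) (t : R) : G :=
  (g j t * (g k t)^-1)%g.

Definition constant_on (R : realType) (T : Type) (I : interval R)
    (f : R -> T) : Prop := {in I &, forall s t, f s = f t}.

Definition left_invariant_coordination (R : realType) (n N : nat)
    (G : lieGroupType R n) (I : interval R) (g : 'I_N -> R -> G) : Prop :=
  forall j k, constant_on I (left_relative_position g j k).

Definition right_invariant_coordination (R : realType) (n N : nat)
    (G : lieGroupType R n) (I : interval R) (g : 'I_N -> R -> G) : Prop :=
  forall j k, constant_on I (right_relative_position g j k).

(* Main.v *)
(* Fix a time t. The right-invariant velocity of g_k at t is the velocity at t of
   b(s) = g_k(s) g_k(t)^-1, a curve through 1; let a be the analogous curve for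
   g_j. Since g_k(s)^-1 g_j(s) = g_k(t)^-1 b(s)^-1 a(s) g_j(t), and this expression
   is constant when a = b, it has zero derivative at t as soon as a and b are
   tangent there; this avoids the product rule on G. A curve with zero
   derivative is locally constant in charts, hence constant on an interval.
   Conversely, if g_k^-1 g_j is constant then a = b near t. The other
   equivalence is the mirror image, with a(s) = g_j(t)^-1 g_j(s). *)

Require Import Defs.
From HB Require Import structures.
From mathcomp Require Import all_boot all_order all_algebra.
From mathcomp Require Import all_classical all_reals all_analysis.
From mathcomp Require Import lra.
Import numFieldNormedType.Exports.
Local Open Scope classical_set_scope.
Local Open Scope ring_scope.

Set Implicit Arguments.
Unset Strict Implicit.
Unset Printing Implicit Defensive.
Import Order.TTheory GRing.Theory Num.Theory.

(** * Differentials and zero derivatives in normed spaces *)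

(** Write [h] as [f + (h - f)]: the second summand vanishes near [x], so its differential there is
    zero. *)
Lemma near_eq_is_diff (R : realType) (V W : normedModType R) (f h df : V -> W)
    (x : V) :
  (\forall y \near x, f y = h y) -> is_diff x f df -> is_diff x h df.
Proof.
move=> fh dfx.
(* The differential of a constant serves as the zero map bundled with a linear structure, the form
   in which [diff_unique] takes its candidate. *)
pose L : {linear V -> W} := 'd (cst (0 : W)) x.
have L0 : L = 0 :> (V -> W) by exact: diff_cst.
have cL : continuous L by rewrite L0; exact: cst_continuous.
have d0 : is_diff x (h - f) 0.
  have e : (h - f) \o shift x = cst ((h - f) x) + L +o_ 0 id.
    rewrite L0; apply/eqaddoP => e e0.
    have: \forall y \near 0, f (y + x) = h (y + x).
      by rewrite (near_shift x 0) sub0r; near=> y; rewrite /= subrK; near: y.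
    apply: filterS => y /= fhy.
    rewrite -[X in `|X|]/((h (y + x) - f (y + x)) - ((h x - f x) + 0)).
    rewrite fhy subrr (nbhs_singleton fh) subrr addr0 subr0 normr0.
    by rewrite mulr_ge0// ltW.
  have dE : 'd (h - f) x = L :> (V -> W) by exact: diff_unique.
  by split; [apply/diff_locallyP; rewrite dE | rewrite dE].
have := is_diffD dfx d0.
rewrite addr0 addrC subrK; exact.
Unshelve. all: by end_near. Qed.

Lemma near_eq_differentiable (R : realType) (V W : normedModType R)
    (f h : V -> W) (x : V) :
  (\forall y \near x, f y = h y) -> differentiable f x -> differentiable h x.
Proof.
by move=> fh /differentiableP df; have [] := near_eq_is_diff fh df.
Qed.

(* The derivative of [Phi (u s, v s)] depends on the derivatives of [u] and [v]
   only, and [Phi (u s, u s)] is constant. *)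
Lemma is_diff0_diagonal_cst (R : realType) (U V W : normedModType R)
    (Phi : V * V -> W) (u v : U -> V) (t : U) :
  u t = v t ->
  (forall y z, Phi (y, y) = Phi (z, z)) ->
  differentiable Phi (u t, u t) ->
  differentiable u t -> differentiable v t -> 'd u t = 'd v t :> (U -> V) ->
  is_diff t (Phi \o (fun s => (u s, v s))) 0.
Proof.
move=> uv cPhi dPhi du dv duv.
have [_ ucst] : is_diff t (Phi \o (fun s => (u s, u s)))
    ('d Phi (u t, u t) \o (fun h => ('d u t h, 'd u t h))).
  by apply: is_diff_comp; [apply: is_diff_pair|]; exact: differentiableP.
have E : Phi \o (fun s => (u s, u s)) = cst (Phi (u t, u t)).
  by apply/funext => s; exact: cPhi.
have -> : (0 : U -> W) =
    'd Phi (u t, u t) \o (fun h => ('d u t h, 'd v t h)).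
  by rewrite -duv -ucst E diff_cst.
apply: is_diff_comp; first by apply: is_diff_pair; exact: differentiableP.
by rewrite -uv; exact: differentiableP.
Qed.

(** Mean value theorem on the segment between [x] and [y], which stays inside a ball where the
    derivative vanishes. *)
Lemma near_derive0_cst (R : realType) (f : R -> R) (x : R) :
  (\forall y \near x, is_derive y (1 : R) f 0) -> \forall y \near x, f y = f x.
Proof.
move=> /nbhs_ballP[e /= e0 df]; apply/nbhs_ballP; exists e => //= y xy.
have seg a b : a <= b -> [set` `[a, b]] `<=` ball x e -> f a = f b.
  move=> ab sub; have [||c _] := @MVT_segment R f (fun=> 0) a b ab.
  - by move=> z zab; apply/df/sub; exact: subset_itv_oo_cc zab.
  - apply: continuous_in_subspaceT => z; rewrite inE => /= /sub/df dfz.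
    exact/differentiable_continuous/derivable1_diffP.
  by rewrite mul0r => /eqP; rewrite subr_eq0 => /eqP.
move: xy; rewrite /ball /= ltr_distl => /andP[xy1 xy2].
have [xy|/ltW yx] := leP x y.
  apply/esym/seg => // z; rewrite /= in_itv/= => /andP[xz zy].
  by rewrite /ball /= ltr_distl; apply/andP; split; lra.
apply/seg => // z; rewrite /= in_itv/= => /andP[xz zy].
by rewrite /ball /= ltr_distl; apply/andP; split; lra.
Qed.

(** The scalar case applies to each entry, and finitely many neighbourhoods of [x] can be
    intersected. *)
Lemma near_derive0_cst_mx (R : realType) (m n : nat) (f : R -> 'M[R]_(m, n))
    (x : R) :
  (\forall y \near x, is_derive y (1 : R) f 0) -> \forall y \near x, f y = f x.
Proof.
move=> df.
have dfij i j : \forall y \near x, f y i j = f x i j.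
  apply: (@near_derive0_cst _ (fun y => f y i j)).
  apply: filterS df => y [dfy dfy0]; split; first exact: (derivable_mxP _ _ _).1.
  have := derive_mx dfy.
  by rewrite dfy0 => /matrixP/(_ i j); rewrite !mxE.
near=> y; apply/matrixP => i j; move: i j; near: y.
by apply: filter_forall => i; apply: filter_forall => j; exact: dfij.
Unshelve. all: by end_near. Qed.

(** Connectedness of the interval: the level set of [f] through [t] is nonempty, open and closed in
    [I]. *)
Lemma near_cst_constant_on (R : realType) (T : Type) (I : interval R)
    (f : R -> T) :
  open [set` I] ->
  (forall t, t \in I -> \forall s \near t, f s = f t) -> constant_on I f.
Proof.
move=> oI fI s t sI tI.
(* Local constancy makes any condition on the value of [f] an open one. Equality with [f t] gives
   openness of the level set, and its negation gives closedness in [I]. *)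
have loc (P : T -> Prop) : open [set x | x \in I /\ P (f x)].
  rewrite openE => x [/= xI Px]; rewrite /interior.
  have nI : nbhs x [set` I] by exact: open_nbhs_nbhs.
  near=> y; split; first by near: y.
  by have -> : f y = f x by near: y; exact: fI.
have /connected_intervalP cI := @interval_is_interval R I.
have sB : [set x | x \in I /\ f x = f t] = [set` I].
  apply: cI; first by exists t.
  - exists [set x | x \in I /\ f x = f t]; first exact: (loc (fun u => u = f t)).
    by apply/seteqP; split=> x /=; tauto.
  - exists (~` [set x | x \in I /\ f x <> f t]).
      by apply: open_closedC; exact: (loc (fun u => u <> f t)).
    apply/seteqP; split=> x /= [xI fx]; first by split=> // -[].
    by split=> //; apply: contrapT => nfx; exact: fx.
by have : [set` I] s := sI; rewrite -sB => -[].
Unshelve. all: by end_near. Qed.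

Lemma smooth_on_differentiable (R : realType) (V W : normedModType R)
    (U : set V) (f : V -> W) (x : V) :
  smooth_on U f -> U x -> differentiable f x.
Proof. by move=> /(_ 1%N)[df _]; exact: df. Qed.

(** [chart_inv c] undoes [c] on [chart_dom c] only, and continuity keeps [f y] there for [y] near
    [x]. The charts are arbitrary so that product charts are covered too. *)
Lemma near_in_charts (X M : topologicalType) (N V W : Type) (c : chart M V)
    (d : chart N W) (F : M -> N) (f : X -> M) (x : X) :
  nbhs (f x) (chart_dom c) ->
  (forall p, chart_dom c p -> chart_inv c (c p) = p) ->
  {for x, continuous f} ->
  \forall y \near x, in_charts c d F (c (f y)) = d (F (f y)).
Proof.
move=> nc cK cf.
by near=> y; rewrite /in_charts cK//; near: y; exact: (cf _ nc).
Unshelve. all: by end_near. Qed.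

(** * Differentiable maps from normed spaces to manifolds, and velocities of curves *)

Section mdifferentiable.
Variables (R : realType) (n : nat).
Implicit Types (M G : smoothManifoldType R n) (V W : normedModType R).

(** The source is any normed space, so that curves, inverses of charts and maps of two coordinate
    vectors are treated alike. *)
Definition mdifferentiable V M (f : V -> M) (x : V) : Prop :=
  {for x, continuous f} /\ differentiable (chart_at (f x) \o f) x.

Lemma nbhs_chart_dom M (c : chart M 'rV[R]_n) (p : M) :
  atlas c -> chart_dom c p -> nbhs p (chart_dom c).
Proof. by move=> /(atlas_chart _)[oc _ _ _ _] cp; exact: open_nbhs_nbhs. Qed.

Lemma chartK M (c : chart M 'rV[R]_n) (p : M) :
  atlas c -> chart_dom c p -> chart_inv c (c p) = p.
Proof. by move=> /(atlas_chart _)[_ _ cK _ _]; exact: cK. Qed.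

Lemma near_in_chart_at (X : topologicalType) M (N W : Type) (d : chart N W)
    (F : M -> N) (f : X -> M) (x : X) :
  {for x, continuous f} ->
  \forall y \near x,
    in_charts (chart_at (f x)) d F (chart_at (f x) (f y)) = d (F (f y)).
Proof.
move=> cf; apply: near_in_charts => //.
  by apply: nbhs_chart_dom; [exact: chart_at_atlas|exact: chart_at_dom].
by move=> p; apply: chartK; exact: chart_at_atlas.
Qed.

Lemma differentiable_curveP M (g : R -> M) (t : R) :
  differentiable_curve g t <-> mdifferentiable g t.
Proof. by split=> -[gc dg]; split=> //; apply/derivable1_diffP. Qed.

(** Near [x], [c \o f] is a transition map after the preferred chart, and the chain rule applies. In
    particular, a differential that is zero in the preferred chart is zero in every chart of the
    atlas around [f x]. *)
Lemma is_diff_chart V M (f : V -> M) (x : V) (c : chart M 'rV[R]_n) :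
  atlas c -> chart_dom c (f x) -> mdifferentiable f x ->
  is_diff x (c \o f)
    ('d (in_charts (chart_at (f x)) c id) (chart_at (f x) (f x))
      \o 'd (chart_at (f x) \o f) x).
Proof.
move=> Ac cfx [cf df]; set d := chart_at (f x).
have Ad : atlas d by exact: chart_at_atlas.
have dfx : chart_dom d (f x) by exact: chart_at_dom.
apply: near_eq_is_diff (near_in_chart_at c id cf) _.
apply: is_diff_comp; first exact: differentiableP.
apply: differentiableP.
apply: smooth_on_differentiable (atlas_compatible _ _ Ad Ac) _.
by exists (f x).
Qed.

Lemma differentiable_chart V M (f : V -> M) (x : V) (c : chart M 'rV[R]_n) :
  atlas c -> chart_dom c (f x) -> mdifferentiable f x ->
  differentiable (c \o f) x.
Proof. by move=> Ac cfx /(is_diff_chart Ac cfx)[]. Qed.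

Lemma mdifferentiable_cst V M (p : M) (x : V) : mdifferentiable (cst p) x.
Proof.
split; first exact: cst_continuous.
exact: (differentiable_cst (chart_at p p : 'rV[R]_n)).
Qed.

Lemma mdifferentiable_comp V W M (f : V -> M) (u : W -> V) (x : W) :
  mdifferentiable f (u x) -> differentiable u x -> mdifferentiable (f \o u) x.
Proof.
move=> [cf df] du; split; last exact: differentiable_comp du df.
by apply: continuous_comp => //; exact: differentiable_continuous.
Qed.

(** Read in a preferred chart, [chart_inv c] is a transition map of the atlas. *)
Lemma mdifferentiable_chart_inv M (c : chart M 'rV[R]_n) (p : M) :
  atlas c -> chart_dom c p -> mdifferentiable (chart_inv c) (c p).
Proof.
move=> Ac cp; have [oc oc' cK _ ccI] := atlas_chart _ Ac.
have cpc : chart_codom c (c p) by exists p.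
split; first exact: ccI.
apply: smooth_on_differentiable (atlas_compatible _ _ Ac (chart_at_atlas _)) _.
exists p => //; split => //=; rewrite cK//; exact: chart_at_dom.
Qed.

Lemma velocity_comp M G (F : M -> G) (g : R -> M) (t : R) :
  mdifferentiable g t ->
  differentiable (in_charts (chart_at (g t)) (chart_at (F (g t))) F)
    (chart_at (g t) (g t)) ->
  tangent_map F (velocity g t) = velocity (F \o g) t.
Proof.
move=> [cg dg] dF.
have nF := near_in_chart_at (chart_at (F (g t))) F cg.
rewrite /velocity /tangent_map (derive1E' dg) [RHS]derive1E.
rewrite -(near_eq_derive _ nF) deriveE; last exact: differentiable_comp dg dF.
by rewrite -[LHS]/((_ \o _) 1) -diff_comp.
Qed.

(** The hypothesis uses a chart that varies with [t]. Near a given [t] the chart [c] at [m t] is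
    kept fixed, and [is_diff_chart] carries the zero differential at each nearby [s] over to [c]. *)
Lemma diff0_constant_on M (I : interval R) (m : R -> M) :
  open [set` I] ->
  (forall t, t \in I -> mdifferentiable m t) ->
  (forall t, t \in I -> 'd (chart_at (m t) \o m) t = 0 :> (R -> _)) ->
  constant_on I m.
Proof.
move=> oI dm dm0; apply: near_cst_constant_on => // t tI.
pose c := chart_at (m t).
have Ac : atlas c by exact: chart_at_atlas.
have nI : \forall s \near t, s \in I by exact: open_nbhs_nbhs.
have nc : \forall s \near t, chart_dom c (m s).
  apply: ((dm _ tI).1 (chart_dom c)).
  by apply: nbhs_chart_dom => //; exact: chart_at_dom.
have : \forall s \near t, c (m s) = c (m t).
  apply: near_derive0_cst_mx; near=> s.
  have sI : s \in I by near: s.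
  have cs : chart_dom c (m s) by near: s.
  have [ds dsE] := is_diff_chart Ac cs (dm _ sI).
  split; first exact: diff_derivable.
  by rewrite deriveE// dsE dm0//= linear0.
move=> ncm; near=> s.
rewrite -[LHS](chartK Ac); last by near: s.
rewrite -[RHS](chartK Ac); last exact: chart_at_dom.
by congr (chart_inv c _); near: s.
Unshelve. all: by end_near. Qed.

End mdifferentiable.

(** * Differentiability of the group operations, and velocities of translated curves *)

Section lie_group.
Variables (R : realType) (n : nat) (G : lieGroupType R n).
Implicit Types (V : normedModType R).

Lemma mdifferentiableM V (f h : V -> G) (x : V) :
  mdifferentiable f x -> mdifferentiable h x ->
  mdifferentiable (fun y => (f y * h y)%g) x.
Proof.
move=> df dh; have [cM sM] := @mulg_smooth R n G.
have cfh : {for x, continuous (fun y => (f y, h y))}.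
  by apply: cvg_pair; [exact: df.1|exact: dh.1].
split; first exact: continuous_comp cfh (cM _).
set e := chart_at _; pose c := chart_at (f x); pose d := chart_at (h x).
have ncd : nbhs (f x, h x) (chart_dom (prod_chart c d)).
  exists (chart_dom c, chart_dom d) => //.
  by split; apply: nbhs_chart_dom; do ?exact: chart_at_atlas; exact: chart_at_dom.
have cdK p : chart_dom (prod_chart c d) p ->
    chart_inv (prod_chart c d) (prod_chart c d p) = p.
  by case: p => p q [/= cp dq]; rewrite !chartK//; exact: chart_at_atlas.
apply: near_eq_differentiable
  (near_in_charts e (fun p => (p.1 * p.2)%g) ncd cdK cfh) _.
apply: differentiable_comp (differentiable_pair df.2 dh.2) _.
apply: smooth_on_differentiable (sM (prod_chart c d) e _ (chart_at_atlas _)) _.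
  by exists c; [exact: chart_at_atlas|exists d => //; exact: chart_at_atlas].
by exists (f x, h x) => //; split; [split|]; exact: chart_at_dom.
Qed.

Lemma mdifferentiableV V (f : V -> G) (x : V) :
  mdifferentiable f x -> mdifferentiable (fun y => (f y)^-1%g) x.
Proof.
move=> df; have [cI sI] := @invg_smooth R n G.
split; first exact: continuous_comp df.1 (cI _).
set e := chart_at _; pose c := chart_at (f x).
apply: near_eq_differentiable (near_in_chart_at e (fun p => p^-1%g) df.1) _.
apply: differentiable_comp df.2 _.
apply: smooth_on_differentiable
  (sI c e (chart_at_atlas _) (chart_at_atlas _)) _.
by exists (f x) => //; split; exact: chart_at_dom.
Qed.

(** Read in the chart at [p], this becomes [is_diff0_diagonal_cst] for [e \o Phi]. The map [F] is
    abstract to serve both quotients, [y^-1 * x] and [x * y^-1]; its differentiability is assumed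
    over every source [V] because it is used on pairs of coordinate vectors. *)
Lemma diff_tangent_curves (F : G -> G -> G) (a b : R -> G) (t : R) (p : G) :
  (forall V (f h : V -> G) x, mdifferentiable f x -> mdifferentiable h x ->
    mdifferentiable (fun y => F (f y) (h y)) x) ->
  (forall x y, F x x = F y y) ->
  a t = p -> b t = p -> mdifferentiable a t -> mdifferentiable b t ->
  derive1 (chart_at p \o a) t = derive1 (chart_at p \o b) t ->
  'd (chart_at (F (a t) (b t)) \o (fun s => F (a s) (b s))) t = 0 :> (R -> _).
Proof.
move=> dF cF at_p bt_p da db dab.
pose c := chart_at p; pose x := c p; pose e := chart_at (F p p).
have Ac : atlas c by exact: chart_at_atlas.
have cp : chart_dom c p by exact: chart_at_dom.
have dca : differentiable (c \o a) t.
  by apply: differentiable_chart da; rewrite ?at_p.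
have dcb : differentiable (c \o b) t.
  by apply: differentiable_chart db; rewrite ?bt_p.
have dci : mdifferentiable (chart_inv c) x by exact: mdifferentiable_chart_inv.
pose Phi (z : 'rV[R]_n * 'rV[R]_n) := F (chart_inv c z.1) (chart_inv c z.2).
have dPhi : differentiable (e \o Phi) (x, x).
  have [_] : mdifferentiable Phi (x, x).
    apply: dF.
      apply: (@mdifferentiable_comp _ _ _ _ _ (chart_inv c) fst) => //.
      by apply: linear_differentiable => z; exact: cvg_fst.
    apply: (@mdifferentiable_comp _ _ _ _ _ (chart_inv c) snd) => //.
    by apply: linear_differentiable => z; exact: cvg_snd.
  by rewrite {1}/Phi /= chartK.
have near_ab : \forall s \near t,
    ((e \o Phi) \o (fun s => ((c \o a) s, (c \o b) s))) s = e (F (a s) (b s)).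
  near=> s; rewrite /Phi /= !chartK//; near: s.
    by apply: (db.1 (chart_dom c)); rewrite bt_p; exact: nbhs_chart_dom.
  by apply: (da.1 (chart_dom c)); rewrite at_p; exact: nbhs_chart_dom.
rewrite at_p bt_p -/e.
(* A linear map on [R] is determined by its value at 1, here the derivative. *)
have dE : 'd (c \o a) t = 'd (c \o b) t :> (R -> _).
  have da1 := diff1E dca; have db1 := diff1E dcb.
  move: dab; rewrite -/c => dab; rewrite dab in da1.
  exact: etrans da1 (esym db1).
have dPhi0 : is_diff t ((e \o Phi) \o (fun s => ((c \o a) s, (c \o b) s))) 0.
  have cab : (c \o a) t = (c \o b) t by rewrite /= at_p bt_p.
  have cPhi y z : (e \o Phi) (y, y) = (e \o Phi) (z, z).
    by rewrite /Phi /= (cF _ (chart_inv c z)).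
  have dPhi_t : differentiable (e \o Phi) ((c \o a) t, (c \o a) t).
    by rewrite [X in differentiable _ (X, X)]/= at_p.
  exact: is_diff0_diagonal_cst cab cPhi dPhi_t dca dcb dE.
by have [] := near_eq_is_diff near_ab dPhi0.
Unshelve. all: by end_near. Qed.

Lemma mdifferentiableMl V (h : G) (f : V -> G) (x : V) :
  mdifferentiable f x -> mdifferentiable (fun y => (h * f y)%g) x.
Proof. by move=> df; apply: mdifferentiableM => //; exact: mdifferentiable_cst. Qed.

Lemma mdifferentiableMr V (h : G) (f : V -> G) (x : V) :
  mdifferentiable f x -> mdifferentiable (fun y => (f y * h)%g) x.
Proof. by move=> df; apply: mdifferentiableM => //; exact: mdifferentiable_cst. Qed.

(** Applying the hypothesis on [F] to the inverse of the chart at [g t] gives the differentiability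
    in coordinates that [velocity_comp] requires. *)
Lemma velocity_translation (F : G -> G) (g : R -> G) (t : R) :
  (forall V (f : V -> G) x, mdifferentiable f x -> mdifferentiable (F \o f) x) ->
  mdifferentiable g t ->
  tangent_map F (velocity g t) = velocity (F \o g) t.
Proof.
move=> dF dg; apply: velocity_comp => //.
have Ac := chart_at_atlas (g t); have cg := chart_at_dom (g t).
have [_] := dF _ _ _ (mdifferentiable_chart_inv Ac cg).
by rewrite /= chartK.
Qed.

Lemma right_velocityE (g : R -> G) (t : R) : mdifferentiable g t ->
  right_velocity g t =
    derive1 (chart_at (1%g : G) \o (fun s => (g s * (g t)^-1)%g)) t.
Proof.
move=> dg; rewrite /right_velocity velocity_translation//; last first.
  by move=> V f x; exact: mdifferentiableMr.
by rewrite /velocity /right_translation /= mulgV.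
Qed.

Lemma left_velocityE (g : R -> G) (t : R) : mdifferentiable g t ->
  left_velocity g t =
    derive1 (chart_at (1%g : G) \o (fun s => ((g t)^-1 * g s)%g)) t.
Proof.
move=> dg; rewrite /left_velocity velocity_translation//; last first.
  by move=> V f x; exact: mdifferentiableMl.
by rewrite /velocity /left_translation /= mulVg.
Qed.

End lie_group.

(** * Coordination versus equality of velocities *)

Theorem proposition1 (R : realType) (n N : nat) (G : lieGroupType R n)
    (I : interval R) (I_open : open [set` I])
    (g : 'I_N -> R -> G)
    (g_diff : forall k t, t \in I -> differentiable_curve (g k) t) :
  (left_invariant_coordination I g <->
     forall j k t, t \in I -> right_velocity (g j) t = right_velocity (g k) t) /\
  (right_invariant_coordination I g <->
     forall j k t, t \in I -> left_velocity (g j) t = left_velocity (g k) t).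
Proof.
have dg k t : t \in I -> mdifferentiable (g k) t.
  by move=> tI; apply/differentiable_curveP; exact: g_diff.
have nI t : t \in I -> \forall s \near t, s \in I.
  by move=> tI; exact: open_nbhs_nbhs.
split; split.
- move=> coord j k t tI.
  rewrite !right_velocityE ?derive1E; do ?exact: dg.
  apply: near_eq_derive; apply: filterS (nI t tI) => s sI /=.
  have := coord j k s t sI tI; rewrite /left_relative_position => gE.
  (* Here g_j(s) = g_k(s) g_k(t)^-1 g_j(t), whose last factor cancels against g_j(t)^-1. *)
  by rewrite -(mulVKg (g k s) (g j s)) gE !mulgA mulgK.
- move=> vE j k; apply: diff0_constant_on => // t tI.
    by apply: mdifferentiableM; [apply: mdifferentiableV|]; exact: dg.
  pose F (x y : G) := ((g k t)^-1 * (y^-1 * x) * g j t)%g.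
  pose a s := (g j s * (g j t)^-1)%g; pose b s := (g k s * (g k t)^-1)%g.
  have -> : left_relative_position g j k = fun s => F (a s) (b s).
    apply/funext => s.
    by rewrite /left_relative_position /F /a /b invgM invgK !mulgA
      mulVg mul1g mulgVK.
  apply: (@diff_tangent_curves _ _ _ F a b t 1%g).
  + move=> V f h x df dh; apply/mdifferentiableMr/mdifferentiableMl.
    by apply: mdifferentiableM => //; exact: mdifferentiableV.
  + by move=> x y; rewrite /F !mulVg.
  + exact: mulgV.
  + exact: mulgV.
  + by apply: mdifferentiableMr; exact: dg.
  + by apply: mdifferentiableMr; exact: dg.
  + rewrite -!right_velocityE; [exact: vE|exact: dg|exact: dg].
- move=> coord j k t tI.
  rewrite !left_velocityE ?derive1E; do ?exact: dg.
  apply: near_eq_derive; apply: filterS (nI t tI) => s sI /=.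
  have := coord j k s t sI tI; rewrite /right_relative_position => gE.
  by rewrite -(mulgVK (g k s) (g j s)) gE !mulgA mulVg mul1g.
- move=> vE j k; apply: diff0_constant_on => // t tI.
    by apply: mdifferentiableM; [|apply: mdifferentiableV]; exact: dg.
  (* The mirrored factorisation is g_j(s) g_k(s)^-1 = g_j(t) a(s) b(s)^-1 g_k(t)^-1. *)
  pose F (x y : G) := (g j t * (x * y^-1) * (g k t)^-1)%g.
  pose a s := ((g j t)^-1 * g j s)%g; pose b s := ((g k t)^-1 * g k s)%g.
  have -> : right_relative_position g j k = fun s => F (a s) (b s).
    apply/funext => s.
    by rewrite /right_relative_position /F /a /b invgM invgK !mulgA
      mulgV mul1g mulgK.
  apply: (@diff_tangent_curves _ _ _ F a b t 1%g).
  + move=> V f h x df dh; apply/mdifferentiableMr/mdifferentiableMl.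
    by apply: mdifferentiableM => //; exact: mdifferentiableV.
  + by move=> x y; rewrite /F !mulgV.
  + exact: mulVg.
  + exact: mulVg.
  + by apply: mdifferentiableMl; exact: dg.
  + by apply: mdifferentiableMl; exact: dg.
  + rewrite -!left_velocityE; [exact: vE|exact: dg|exact: dg].
Qed.
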